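(* Under the model and assumptions (A1)--(A3), (B1)--(B6) in the context, let $\hat\theta_n^\phi$ be a minimum $\phi$-divergence estimator which is a BAN estimator of the parameter $\theta$ (with true value $\theta_0$). Then $$\sup_{p\in[0,1]}\left|qD\left(p;Q_{\hat\theta_n^\phi}\right)-qD(p;Q_{\theta_0})\right|\xrightarrow{P}0$$ as $n\to\infty$.
   Context: Model. $X_1,\ldots,X_n$ are iid nonnegative random variables with cumulative distribution function $F_{\theta_0}$, an element of a family $\{F_\theta:\theta\in\Theta\}$, $\Theta\subset\mathbb{R}^s$. Let $0=c_0<c_1<\cdots<c_{k-1}<c_k=\infty$ be fixed, so that $[0,c_1),[c_1,c_2),\ldots,[c_{k-1},\infty)$ is a partition of $[0,\infty)$ into $k$ intervals, with $k>s+1$. Only the interval containing each $X_j$ is observed. Let $g(\theta)=(g_1(\theta),\ldots,g_k(\theta))$, $g_i(\theta)=F_\theta(c_i)-F_\theta(c_{i-1})$ (with $F_\theta(\infty)=1$), and $\Delta_k=\{(p_1,\ldots,p_k): p_i\ge 0,\ \sum_{i=1}^k p_i=1\}$. Let $\Pi_0=g(\Theta)\subset\Delta_k$. Let $P=(p_1,\ldots,p_k)$ be the vector of observed frequencies, $p_i=\frac1n\sum_{j=1}^n \mathbf{1}\{X_j\in[c_{i-1},c_i)\}$. Assumptions. (A1) For every $\theta\in\Theta$, $F_\theta$ is absolutely continuous and strictly increasing on $[0,\infty)$, and $F_\theta(0)=0$. (A2) The true value $\theta_0$ of the $s$-dimensional parameter is an interior point of $\Theta$, which is a compact subset of $\mathbb{R}^s$.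 (A3) For every $p\in(0,1)$, $Q_\theta(p)=F_\theta^{-1}(p)$ is a continuous function of $\theta$. (B1) $g_i(\theta_0)>0$ for $i=1,\ldots,k$. (B2) $g:\Theta\to\Delta_k$ is totally differentiable at $\theta_0$: the partial derivatives of each $g_i$ with respect to each $\theta_j$ exist at $\theta_0$ and $g(\theta)=g(\theta_0)+\frac{\partial g(\theta_0)}{\partial\theta}(\theta-\theta_0)+o(\|\theta-\theta_0\|)$ as $\theta\to\theta_0$, where $\frac{\partial g(\theta_0)}{\partial\theta}$ is the $k\times s$ matrix with $(i,j)$ entry $\frac{\partial g_i(\theta_0)}{\partial\theta_j}$. (B3) The Jacobian matrix $\frac{\partial g(\theta_0)}{\partial\theta}$ has full rank $s$. (B4) The inverse mapping $g^{-1}:\Pi_0\to\Theta$ (assumed to exist) is continuous at $g(\theta_0)$. (B5) $g:\Theta\to\Delta_k$ is continuous at every $\theta\in\Theta$. (B6) $g$ has continuous second partial derivatives in a neighbourhood of $\theta_0$. Estimators. A minimum $\phi$-divergence estimator $\hat\theta_n^\phi$ is a $\Theta$-valued estimator based on the sample of size $n$ with $\hat\theta_n^\phi\in\operatorname{arg\,min}_{\theta\in\Theta} d_\phi(P,g(\theta))$, where $d_\phi(P,g(\theta))=\sum_{i=1}^k g_i(\theta)\,\phi\left(\frac{p_i}{g_i(\theta)}\right)$ for a continuous convex $\phi:[0,\infty)\to\mathbb{R}\cup\{\infty\}$ with $\phi(1)=0$, $0\phi(0/0)=0$, $0\phi(t/0)=t\lim_{u\to\infty}\phi(u)/u$ for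 $t>0$. It is BAN (best asymptotically normal) if it is asymptotically normal and asymptotically efficient, i.e. $\sqrt n(\hat\theta_n^\phi-\theta_0)\xrightarrow{d}\mathcal N(\mathbf 0,I_{\theta_0}^{-1})$, where $I_{\theta}$ is the Fisher information matrix of the multinomial model with $k$ cells and cell probabilities $g(\theta)$, so $I_{\theta_0}=\left(\frac{\partial g(\theta_0)}{\partial\theta}\right)^{\top}\mathrm{diag}\left(\frac{1}{g_1(\theta_0)},\ldots,\frac1{g_k(\theta_0)}\right)\frac{\partial g(\theta_0)}{\partial\theta}$. Inequality curve. For $p\in(0,1)$, $qD(p;Q_\theta)=1-\frac{Q_\theta(p/2)}{Q_\theta(1-p/2)}$; moreover $qD(0;Q_\theta)=1$ and $qD(1;Q_\theta)=0$. *)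

(* Defs.v *)
From HB Require Import structures.
From mathcomp Require Import all_boot all_order all_algebra.
From mathcomp Require Import finmap.
From mathcomp Require Import all_classical all_reals all_analysis.

Set Implicit Arguments.
Unset Strict Implicit.
Unset Printing Implicit Defensive.

Import Order.TTheory GRing.Theory Num.Theory.
Import numFieldNormedType.Exports.

Local Open Scope classical_set_scope.
Local Open Scope ring_scope.

Notation borel_rV R s := (g_sigma_algebraType (@open 'rV[R]_s)).

Section DistributionFunctions.
Context {R : realType}.
Implicit Types (F Q : R -> R) (A : set R).

Definition is_cdf F :=
  [/\ nondecreasing_fun F, right_continuous F,
      F x @[x --> -oo] --> (0 : R) & F x @[x --> +oo] --> (1 : R)].

Definition absolutely_continuous_on A F :=
  forall e : R, 0 < e -> exists2 d : R, 0 < d &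
    forall (m : nat) (a b : 'I_m -> R),
      (forall i, [/\ A (a i), A (b i) & a i <= b i]) ->
      trivIset setT (fun i => `]a i, b i[%classic) ->
      \sum_(i < m) (b i - a i) < d ->
      \sum_(i < m) `|F (b i) - F (a i)| < e.

Definition cdf_ext F (x : \bar R) : R :=
  match x with r%:E => F r | +oo%E => 1 | -oo%E => 0 end.

(* The inverse of F as a function on the support [0, +oo[. *)
Definition quantile F : R -> R := pinv [set x : R | 0 <= x] F.

Definition qD Q (p : R) : R :=
  if p == 0 then 1 else if p == 1 then 0 else 1 - Q (p / 2) / Q (1 - p / 2).

(* On [0, 1], qD takes values in [0, 1] for the quantile functions
   considered here, so that this real-valued sup is the actual supremum. *)
Definition qD_dist Q1 Q2 : R :=
  sup [set `|qD Q1 p - qD Q2 p| | p in `[0, 1]%classic].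

End DistributionFunctions.

Section GroupedModel.
Context {R : realType} {s k : nat}.
Implicit Types (F : 'rV[R]_s -> R -> R) (c : nat -> \bar R).
Implicit Types (g : 'rV[R]_s -> 'rV[R]_k) (t : 'rV[R]_s).

(* The cells are numbered from 0: cell i is [c_i, c_(i+1)[. *)
Definition cell_prob F c t : 'rV[R]_k :=
  \row_i (cdf_ext (F t) (c i.+1) - cdf_ext (F t) (c i)).

Definition partial (h : 'rV[R]_s -> R) (j : 'I_s) : 'rV[R]_s -> R :=
  fun t => 'D_(delta_mx 0 j) h t.

Definition continuous_second_partials_near g t0 :=
  \forall t \near t0, forall (i : 'I_k) (j l : 'I_s),
    let gi := fun u => g u 0 i in
    [/\ derivable gi t (delta_mx 0 j),
        derivable (partial gi j) t (delta_mx 0 l) &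
        {for t, continuous (partial (partial gi j) l)}].

(* MathComp-Analysis acts on row vectors: 'J g t is the s x k matrix whose
   (j, i) entry is the partial derivative of g_i with respect to t_j, i.e. the
   transpose of the usual Jacobian matrix. *)
Definition fisher_info g t : 'M[R]_s :=
  'J g t *m diag_mx (\row_i (g t 0 i)^-1) *m ('J g t)^T.

End GroupedModel.

Section Divergence.
Context {R : realType}.
Implicit Type phi : R -> \bar R.

Definition divergence_generator phi :=
  [/\ forall x : R, 0 <= x -> phi x != -oo%E,
      {within [set x : R | 0 <= x], continuous phi},
      forall x y l : R, 0 <= x -> 0 <= y -> 0 <= l <= 1 ->
        (phi (l * x + (1 - l) * y)%R <= l%:E * phi x + (1 - l)%:E * phi y)%E &
      phi 1 = 0%E].

(* q * phi (p / q), with the conventions for q = 0. *)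
Definition divergence_term phi (p q : R) : \bar R :=
  if q == 0 then
    if p == 0 then 0%E
    else (p%:E * lim ((phi u * (u^-1)%:E)%E @[u --> +oo%R]))%E
  else (q%:E * phi (p / q)%R)%E.

Definition phi_divergence {k : nat} phi (p q : 'rV[R]_k) : \bar R :=
  (\sum_(i < k) divergence_term phi (p ord0 i) (q ord0 i))%E.

End Divergence.

Section Probability.
Context {d : measure_display} {T : measurableType d} {R : realType}.
Variable P : probability T R.

Definition mutually_independent (X : nat -> {RV P >-> R}) :=
  forall (J : {fset nat}) (A : nat -> set R), (forall j, measurable (A j)) ->
    P (\bigcap_(j in [set` J]) X j @^-1` A j) =
    (\prod_(j <- J) P (X j @^-1` A j))%E.

Definition cvg_in_probability (Y : nat -> T -> R) (l : R) :=
  forall e : R, 0 < e ->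
    P [set w | e <= `|Y n w - l|] @[n --> \oo] --> (0 : \bar R)%E.

Definition cvg_in_law {s : nat} (Y : nat -> T -> 'rV[R]_s)
    (mu : probability (borel_rV R s) R) :=
  forall f : 'rV[R]_s -> R, continuous f ->
    (exists M : R, forall x, `|f x| <= M) ->
    (\int[P]_w (f (Y n w))%:E)%E @[n --> \oo] --> (\int[mu]_x (f x)%:E)%E.

End Probability.

Section Normal.
Context {R : realType}.

(* normal_prob m 0 is not the degenerate law in the library. *)
Definition normal_law (m v : R) (A : set R) : \bar R :=
  if v == 0 then \d_m A else normal_prob m (Num.sqrt v) A.

(* mu is N(m, S) when every linear form u has law N(<u, m>, u S u^T). *)
Definition is_multinormal {s : nat} (m : 'rV[R]_s) (S : 'M[R]_s)
    (mu : probability (borel_rV R s) R) :=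
  forall (u : 'rV[R]_s) (A : set R), measurable A ->
    mu [set x | A ((x *m u^T) 0 0)] =
    normal_law ((m *m u^T) 0 0) ((u *m S *m u^T) 0 0) A.

End Normal.

Section Estimation.
Context {d : measure_display} {T : measurableType d} {R : realType}.
Context {P : probability T R} {s : nat}.
Implicit Types (X : nat -> {RV P >-> R}) (est : nat -> {RV P >-> borel_rV R s}).

(* The observations are numbered from 0: X_1, ..., X_n are X 0, ..., X n.-1. *)
Definition frequencies {k : nat} X (c : nat -> \bar R) (n : nat) (w : T) :
    'rV[R]_k :=
  \row_(i < k) (n%:R^-1 * \sum_(j < n) ((c i <= (X j w)%:E < c i.+1)%E)%:R).

Definition based_on_sample X est :=
  forall n, exists f : 'rV[R]_n -> 'rV[R]_s,
    forall w, est n w = f (\row_(j < n) X j w).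

Definition min_phi_divergence_estimator {k : nat} X (c : nat -> \bar R)
    (Theta : set 'rV[R]_s) (g : 'rV[R]_s -> 'rV[R]_k) (phi : R -> \bar R) est :=
  based_on_sample X est /\
  forall (n : nat) (w : T), (0 < n)%N ->
    Theta (est n w) /\
    forall t, Theta t ->
      (phi_divergence phi (frequencies X c n w) (g (est n w)) <=
       phi_divergence phi (frequencies X c n w) (g t))%E.

Definition BAN_estimator {k : nat} (g : 'rV[R]_s -> 'rV[R]_k) (t0 : 'rV[R]_s)
    est :=
  exists2 mu : probability (borel_rV R s) R,
    is_multinormal 0 (invmx (fisher_info g t0)) mu &
    cvg_in_law P
      (fun n w => Num.sqrt (n%:R : R) *: ((est n w : 'rV[R]_s) - t0)) mu.

End Estimation.

(* Main.v *)
Require Import Defs.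
From HB Require Import structures.
From mathcomp Require Import all_boot all_order all_algebra.
From mathcomp Require Import finmap.
From mathcomp Require Import all_classical all_reals all_analysis.
From mathcomp Require Import measurable_realfun lra.

Set Implicit Arguments.
Unset Strict Implicit.
Unset Printing Implicit Defensive.

Import Order.TTheory GRing.Theory Num.Theory.
Import numFieldNormedType.Exports.

Local Open Scope classical_set_scope.
Local Open Scope ring_scope.

(** The proof is a continuous mapping argument at theta0.

    Consistency.  The rescaled error sqrt n (est n - theta0) converges in law,
    and the limit law is tight, so the rescaled error stays bounded in
    probability; dividing by sqrt n gives est n --> theta0 in probability
    (cvg_in_law_consistent).

    Continuity.  The function t |-> sup_p |qD (p; Q_t) - qD (p; Q_theta0)| is
    continuous on Theta (qD_dist_continuous).  Pointwise in p this is the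
    assumed continuity of t |-> Q_t(p).  Uniformity in p comes from Polya's
    argument: every curve qD (.; Q_t) is nonincreasing from 1 to 0 and takes all
    the values in between (qD_onto), so closeness at the m + 1 points where the
    limit curve equals i / m forces closeness up to 3 / m on all of [0, 1]
    (nonincreasing_grid_close).

    Since est n lies in Theta for n > 0, composing the two gives the theorem
    (consistent_continuous_map). *)

(** * Uniform closeness of monotone curves *)

(** The deterministic half of Polya's theorem.  If i is the integer part of
    m * h p, then p lies between the grid points where h takes the values
    (i + 1) / m and (i - 1) / m.  By monotonicity h' p is squeezed between the
    values of h' there, which are known up to 1 / m; past either end of the grid
    the bound 0 or 1 on h' takes over. *)
Lemma nonincreasing_grid_close (R : realType) (m : nat) (h h' : R -> R)
    (x : 'I_m.+1 -> R) :
  (0 < m)%N ->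
  {in `[0, 1] &, {homo h : p q /~ p <= q}} ->
  {in `[0, 1] &, {homo h' : p q /~ p <= q}} ->
  {in `[0, 1], forall p, 0 <= h p <= 1} ->
  {in `[0, 1], forall p, 0 <= h' p <= 1} ->
  (forall i, x i \in `[0, 1]) ->
  (forall i, h (x i) = i%:R / m%:R) ->
  (forall i, `|h' (x i) - h (x i)| <= m%:R^-1) ->
  {in `[0, 1], forall p, `|h' p - h p| <= 3 / m%:R}.
Proof.
move=> m0 hmono h'mono h01 h'01 x01 hx close p p01.
have m0R : 0 < m%:R :> R by rewrite ltr0n.
set u := m%:R^-1 in hx close *.
have u0 : 0 < u by rewrite invr_gt0.
have um : m%:R * u = 1 by rewrite divff// gt_eqF.
have [hp0 hp1] := andP (h01 _ p01); have [h'p0 h'p1] := andP (h'01 _ p01).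
pose i := Num.truncn (h p * m%:R).
have /andP[ilo ihi] : i%:R * u <= h p < i.+1%:R * u.
  rewrite ler_pdivrMr// ltr_pdivlMr//.
  exact/truncn_itv/mulr_ge0/ltW.
rewrite ler_distl; apply/andP; split.
  have [i0|i0] := posnP i; first by move: ihi; rewrite i0; lra.
  (* The value (i - 1) / m is used because h p may be equal to i / m, in which
     case p cannot be compared with the grid point of index i. *)
  have im : (i.-1 < m.+1)%N.
    by rewrite prednK// leqW// -(ler_nat R) -(ler_pM2r u0) um (le_trans ilo).
  have := x01 (Ordinal im).
  move: (hx (Ordinal im)) (close (Ordinal im)).
  set q := x _ => hq; rewrite ler_distl hq => /andP[cl _] q01.
  have iS : i%:R = (i.-1)%:R + 1 :> R by rewrite natr1 prednK.
  have pq : p <= q.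
    rewrite leNgt; apply/negP => /ltW qp.
    have := hmono _ _ p01 q01 qp; rewrite hq /=.
    by move: ilo; rewrite iS; lra.
  have := h'mono _ _ q01 p01 pq.
  by move: cl ihi; rewrite /= -natr1 iS; lra.
have [im|im] := ltnP i m.
  pose j : 'I_m.+1 := Ordinal (im : (i.+1 < m.+1)%N).
  have := x01 j; move: (hx j) (close j).
  set q := x _ => hq; rewrite ler_distl hq => /andP[_ cl] q01.
  have qp : q <= p.
    rewrite leNgt; apply/negP => /ltW pq.
    by have := hmono _ _ q01 p01 pq; rewrite hq /= leNgt ihi.
  have := h'mono _ _ p01 q01 qp.
  by move: cl ilo; rewrite /= -natr1; lra.
(* No grid value exceeds h p, hence h p is at least 1. *)
have : (m%:R : R) <= i%:R by rewrite ler_nat.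
nra.
Qed.

(** * Quantiles of a lifetime distribution *)

Definition lifetime_cdf (R : realType) (F : R -> R) :=
  [/\ is_cdf F,
      absolutely_continuous_on [set x : R | 0 <= x] F,
      {in [set x : R | 0 <= x] &, {homo F : x y / x < y}} & F 0 = 0].

Lemma lifetime_cdf_neg (R : realType) (F : R -> R) x :
  lifetime_cdf F -> x <= 0 -> F x = 0.
Proof.
move=> [[Fmono _ FNy _] _ _ F0] x0.
apply/eqP; rewrite eq_le -{1}F0 Fmono//= leNgt; apply/negP => Fx0.
have : \forall y \near -oo, F x < F y by exact: cvgr_gt FNy _ Fx0.
have : \forall y \near -oo, y <= x by apply: nbhs_ninfty_le; rewrite num_real.
move=> yx Fxy; have [y [yx' +]] : exists y, y <= x /\ F x < F y.
  by near (ninfty_nbhs R) => y; exists y; split; near: y.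
by rewrite ltNge Fmono.
Unshelve. all: by end_near. Qed.

(** Absolute continuity, applied to a single interval, gives uniform continuity
    on the half-line; F vanishes on negative numbers, so F x = F (max x 0)
    transfers it to all of R. *)
Lemma lifetime_cdf_continuous (R : realType) (F : R -> R) :
  lifetime_cdf F -> continuous F.
Proof.
move=> LF; have [_ AC _ F0] := LF => x.
have Fmax y : F y = F (Num.max y 0).
  have [y0|y0] := leP y 0; last by [].
  by rewrite F0 lifetime_cdf_neg.
apply/cvgrPdist_lt => e e0; have [d d0 dF] := AC e e0.
have FI a b : 0 <= a -> a <= b -> b - a < d -> `|F b - F a| < e.
  move=> a0 ab bad; have := dF 1%N (fun=> a) (fun=> b).
  rewrite !big_ord1; apply => //.
    by move=> _; split=> //=; exact: le_trans ab.
  by move=> i j _ _ _; rewrite !ord1.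
have Fclose y z : `|y - z| < d -> `|F y - F z| < e.
  wlog zy : y z / z <= y.
    move=> H; have [/H//|/ltW yz] := leP z y.
    by rewrite distrC (distrC (F _)); exact: H.
  rewrite ger0_norm ?subr_ge0// => yzd.
  rewrite (Fmax y) (Fmax z); apply: FI.
  - by rewrite le_max lexx orbT.
  - by rewrite ge_max !le_max zy lexx orbT.
  - by rewrite /Num.max; case: ifP; case: ifP; lra.
by near=> y; apply: Fclose; near: y; exact: cvgr_dist_lt.
Unshelve. all: by end_near. Qed.

Lemma quantile_cdfK (R : realType) (F : R -> R) :
  lifetime_cdf F -> {in [set x : R | 0 <= x], cancel F (quantile F)}.
Proof.
move=> [_ _ Finc _]; apply: pinvKV => x y x0 y0 Fxy.
have [xy|yx|//] := ltgtP x y.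
  by have := Finc _ _ x0 y0 xy; rewrite Fxy ltxx.
by have := Finc _ _ y0 x0 yx; rewrite Fxy ltxx.
Qed.

Lemma lifetime_cdf_onto (R : realType) (F : R -> R) p :
  lifetime_cdf F -> 0 <= p < 1 -> exists2 x, 0 <= x & F x = p.
Proof.
move=> LF /andP[p0 p1]; have [[Fmono _ _ Fy] _ _ F0] := LF.
have [b [b0 pb]] : exists b, 0 <= b /\ p < F b.
  have ? : \forall y \near +oo, p < F y by exact: cvgr_gt Fy _ p1.
  have ? : \forall y \near +oo, 0 <= y :> R.
    by apply: nbhs_pinfty_ge; rewrite num_real.
  by near (pinfty_nbhs R) => y; exists y; split; near: y.
have [||x] := @IVT R F 0 b p b0.
- by apply: continuous_subspaceT; exact: lifetime_cdf_continuous.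
- by rewrite F0 ge_min p0 le_max (ltW pb) orbT.
by rewrite in_itv/= => /andP[x0 _] <-; exists x.
Unshelve. all: by end_near. Qed.

(** The interval is open at 1: a lifetime with unbounded support has no quantile
    of order 1, and quantile F 1 is then an arbitrary value. *)
Definition increasing_quantile (R : realType) (Q : R -> R) :=
  Q 0 = 0 /\ {in `[0, 1[ &, {homo Q : p q / p < q}}.

Lemma lifetime_quantile (R : realType) (F : R -> R) :
  lifetime_cdf F -> increasing_quantile (quantile F).
Proof.
move=> LF; have [[Fmono _ _ _] _ _ F0] := LF.
split; first by rewrite -[X in quantile F X]F0 quantile_cdfK// inE/=.
move=> p q; rewrite !in_itv/= => /(lifetime_cdf_onto LF)[x x0 <-].
move=> /(lifetime_cdf_onto LF)[y y0 <-].
rewrite !quantile_cdfK ?inE//; apply: contraTT.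
by rewrite -!leNgt => /Fmono.
Qed.

Lemma increasing_quantile_mono (R : realType) (Q : R -> R) :
  increasing_quantile Q -> {in `[0, 1[ &, {homo Q : p q / p <= q}}.
Proof.
move=> [_ Qinc] p q p01 q01; rewrite le_eqVlt => /predU1P[->//|pq].
exact/ltW/Qinc.
Qed.

Lemma increasing_quantile_gt0 (R : realType) (Q : R -> R) p :
  increasing_quantile Q -> 0 < p < 1 -> 0 < Q p.
Proof.
move=> [Q0 Qinc] /andP[p0 p1]; rewrite -Q0.
by apply: Qinc; rewrite // in_itv/= ?lexx ?(ltW p0) ?ltr01.
Qed.

(** * The inequality curve *)

(** The values imposed at 0 and 1 agree with the general formula: Q 0 = 0 makes
    the ratio vanish at p = 0 whatever Q 1 is, and both quantiles are the median
    at p = 1. *)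
Lemma qDE (R : realType) (Q : R -> R) p : increasing_quantile Q ->
  qD Q p = 1 - Q (p / 2) / Q (1 - p / 2).
Proof.
move=> IQ; rewrite /qD; case: eqP => [->|_].
  by rewrite mul0r IQ.1 mul0r subr0.
case: eqP => [->|//]; rewrite (_ : 1 - 1 / 2 = 1 / 2); last lra.
rewrite divff ?subrr// gt_eqF// increasing_quantile_gt0//; lra.
Qed.

Lemma qD_itv (R : realType) (Q : R -> R) : increasing_quantile Q ->
  {in `[0, 1], forall p, 0 <= qD Q p <= 1}.
Proof.
move=> IQ p; rewrite in_itv/= => /andP[p0 p1].
have [->|pN0] := eqVneq p 0; first by rewrite /qD eqxx ler01 lexx.
have p_gt0 : 0 < p by rewrite lt_neqAle eq_sym pN0.
have Qp : 0 < Q (p / 2) by apply: increasing_quantile_gt0 => //; lra.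
have Qq : 0 < Q (1 - p / 2) by apply: increasing_quantile_gt0 => //; lra.
rewrite qDE// subr_ge0 ler_pdivrMr// mul1r.
rewrite increasing_quantile_mono ?in_itv//=; try lra.
by rewrite lerBlDr lerDl divr_ge0// ltW.
Qed.

Lemma qD_nonincreasing (R : realType) (Q : R -> R) : increasing_quantile Q ->
  {in `[0, 1] &, {homo qD Q : p q /~ p <= q}}.
Proof.
move=> IQ q p q01 p01 pq.
have [p0|pN0] := eqVneq p 0.
  by rewrite p0 {2}/qD eqxx; case/andP: (qD_itv IQ q01).
move: p01 q01; rewrite !in_itv/= => /andP[p0 p1] /andP[q0 q1].
have p_gt0 : 0 < p by rewrite lt_neqAle eq_sym pN0.
have Qp : 0 < Q (1 - p / 2) by apply: increasing_quantile_gt0 => //; lra.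
have Qq : 0 < Q (1 - q / 2) by apply: increasing_quantile_gt0 => //; lra.
have Qp' : 0 < Q (p / 2) by apply: increasing_quantile_gt0 => //; lra.
rewrite !qDE// lerD2l lerN2 ler_pM// ?invr_ge0 ?(ltW Qp) ?(ltW Qp')//.
  by apply: increasing_quantile_mono; rewrite // ?in_itv/=; lra.
rewrite lef_pV2//.
by apply: increasing_quantile_mono; rewrite // ?in_itv/=; lra.
Qed.

(** Writing z for the quantile of order 1 - p / 2, the equation qD p = y says
    that the quantile of order p / 2 is r z with r = 1 - y, that is
    F (r z) + F z = 1.  The left-hand side is continuous in z, so the
    intermediate value theorem provides z. *)
Lemma qD_onto (R : realType) (F : R -> R) y : lifetime_cdf F ->
  0 <= y <= 1 -> exists2 p, p \in `[0, 1] & qD (quantile F) p = y.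
Proof.
move=> LF /andP[y0 y1]; have [[Fmono _ _ Fy] _ Finc F0] := LF.
have [->|yN1] := eqVneq y 1.
  by exists 0; rewrite ?in_itv/= ?lexx ?ler01// /qD eqxx.
pose r := 1 - y.
have r0 : 0 < r by rewrite subr_gt0 lt_neqAle yN1.
have r1 : r <= 1 by rewrite lerBlDr lerDl.
have [c c0 Fc] : exists2 x, 0 <= x & F x = 1 / 2.
  by apply: lifetime_cdf_onto => //; lra.
(* At z = c / r both terms F (r z) and F z are at least F c = 1 / 2. *)
have cr : 0 <= c / r by rewrite divr_ge0// ltW.
have Fcont := lifetime_cdf_continuous LF.
have [||z] := @IVT R (fun z => F (r * z) + F z) 0 (c / r) 1 cr.
- apply: continuous_subspaceT => z; apply: cvgD; last exact: Fcont.
  apply: (@continuous_comp _ _ _ (fun z => r * z) F); last exact: Fcont.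
  exact: mulrl_continuous.
- rewrite mulr0 F0 addr0 ge_min ler01/= le_max mulrC divfK ?gt_eqF// Fc.
  have : F c <= F (c / r) by apply: Fmono; rewrite ler_pdivlMr// ler_piMr.
  by rewrite Fc => ?; apply/orP; right; lra.
rewrite in_itv/= => /andP[z0 _] Fz.
have rz : r * z <= z by rewrite ler_piMl.
have rz0 : 0 <= r * z by rewrite mulr_ge0// ltW.
have Frz : F (r * z) <= F z by exact: Fmono.
have Frz0 : 0 <= F (r * z) by rewrite -F0 Fmono.
exists (2 * F (r * z)); first by rewrite in_itv/=; lra.
rewrite qDE; last exact: lifetime_quantile.
rewrite [2 * _]mulrC mulfK// (_ : 1 - F (r * z) = F z); last lra.
rewrite !quantile_cdfK ?inE// mulfK; first by rewrite /r; lra.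
apply/eqP => z00; move: Fz; rewrite z00 mulr0 F0; lra.
Qed.

Lemma qD_dist_ub (R : realType) (Q1 Q2 : R -> R) :
  increasing_quantile Q1 -> increasing_quantile Q2 ->
  {in `[0, 1], forall p, `|qD Q1 p - qD Q2 p| <= qD_dist Q1 Q2}.
Proof.
move=> IQ1 IQ2 p p01; apply: ub_le_sup; last by exists p.
exists 1 => _ [q /= q01 <-].
have /andP[? ?] := qD_itv IQ1 q01; have /andP[? ?] := qD_itv IQ2 q01.
by rewrite ler_norml; lra.
Qed.

Lemma qD_distxx (R : realType) (Q : R -> R) : qD_dist Q Q = 0.
Proof.
rewrite /qD_dist (_ : [set _ | _ in _] = [set 0]) ?sup1//.
apply/seteqP; split=> [_ [p _ <-]|_ ->] /=; first by rewrite subrr normr0.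
by exists 0; rewrite ?subrr ?normr0//= in_itv/= lexx ler01.
Qed.

Lemma qD_dist_le (R : realType) (Q1 Q2 : R -> R) e :
  {in `[0, 1], forall p, `|qD Q1 p - qD Q2 p| <= e} -> qD_dist Q1 Q2 <= e.
Proof.
move=> H; apply: ge_sup; last by move=> _ [p p01 <-]; exact: H.
by exists `|qD Q1 0 - qD Q2 0|; exists 0 => //=; rewrite in_itv/= lexx ler01.
Qed.

Lemma qD_dist_lipschitz (R : realType) (Q0 Q1 Q2 : R -> R) e :
  increasing_quantile Q0 -> increasing_quantile Q1 -> increasing_quantile Q2 ->
  {in `[0, 1], forall p, `|qD Q1 p - qD Q2 p| <= e} ->
  `|qD_dist Q1 Q0 - qD_dist Q2 Q0| <= e.
Proof.
move=> IQ0; have H (Q Q' : R -> R) : increasing_quantile Q' ->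
    {in `[0, 1], forall p, `|qD Q p - qD Q' p| <= e} ->
    qD_dist Q Q0 <= qD_dist Q' Q0 + e.
  move=> IQ' QQ'; apply: qD_dist_le => p p01.
  rewrite (le_trans (ler_distD (qD Q' p) _ _))// addrC lerD//; last exact: QQ'.
  exact: qD_dist_ub.
move=> IQ1 IQ2 Q12; rewrite ler_distlC; apply/andP; split.
  by rewrite lerBlDr; exact: H.
by apply: H => // p p01; rewrite distrC; exact: Q12.
Qed.

(** The finitely many conditions at the grid points of qD (.; Q_t) hold for all
    parameters near t; monotonicity makes them uniform in p. *)
Lemma qD_dist_continuous (R : realType) (s : nat) (Theta : set 'rV[R]_s)
    (F : 'rV[R]_s -> R -> R) (Q0 : R -> R) :
  (forall t, Theta t -> lifetime_cdf (F t)) ->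
  (forall p, 0 < p < 1 ->
    {within Theta, continuous (fun t => quantile (F t) p)}) ->
  increasing_quantile Q0 ->
  {within Theta, continuous (fun t => qD_dist (quantile (F t)) Q0)}.
Proof.
move=> LF Qcont IQ0; apply/subspace_continuousP => t Tt.
have qDcont p : p \in `[0, 1] ->
    qD (quantile (F u)) p @[u --> within Theta (nbhs t)]
      --> qD (quantile (F t)) p.
  rewrite in_itv/= => /andP[p0 p1]; rewrite /qD.
  case: eqP => [_|/eqP pN0]; first exact: cvg_cst.
  case: eqP => [_|/eqP pN1]; first exact: cvg_cst.
  have p_gt0 : 0 < p by rewrite lt_neqAle eq_sym pN0.
  have p_lt1 : p < 1 by rewrite lt_neqAle pN1.
  have pcont q : 0 < q < 1 ->
      quantile (F u) q @[u --> within Theta (nbhs t)] --> quantile (F t) q.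
    by move=> q01; exact: (subspace_continuousP _ _).1 (Qcont q q01) t Tt.
  have Qp : 0 < quantile (F t) (1 - p / 2).
    by apply: increasing_quantile_gt0; [exact/lifetime_quantile/LF|lra].
  apply: cvgB; first exact: cvg_cst.
  apply: cvgM; first by apply: pcont; lra.
  by apply: cvgV; [rewrite gt_eqF|apply: pcont; lra].
apply/cvgrPdist_le => e e0.
pose m := (Num.truncn (3 / e)).+1.
have m0R : 0 < m%:R :> R by rewrite ltr0n.
have me : 3 / m%:R <= e.
  by rewrite ler_pdivrMr// mulrC -ler_pdivrMr// ltW// truncnS_gt.
have /choice[x xP] (i : 'I_m.+1) : exists p,
    p \in `[0, 1] /\ qD (quantile (F t)) p = i%:R / m%:R.
  have [||p p01 hp] := @qD_onto R (F t) (i%:R / m%:R); first exact: LF.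
    by rewrite divr_ge0//= ler_pdivrMr// mul1r ler_nat -ltnS.
  by exists p.
have grid : \forall u \near within Theta (nbhs t),
    forall i, `|qD (quantile (F u)) (x i) - qD (quantile (F t)) (x i)|
      <= m%:R^-1.
  apply: filter_forall => i; near=> u; rewrite distrC; near: u.
  by apply: cvgr_dist_le; [apply: qDcont; case: (xP i)|rewrite invr_gt0].
near=> u.
have Tu : Theta u by near: u; exact: withinT.
have IQt : increasing_quantile (quantile (F t)) by exact/lifetime_quantile/LF.
have IQu : increasing_quantile (quantile (F u)) by exact/lifetime_quantile/LF.
apply: qD_dist_lipschitz => // p p01; rewrite distrC (le_trans _ me)//.
move: p p01; apply: (nonincreasing_grid_close (x := x)) => //.
- exact: qD_nonincreasing.
- exact: qD_nonincreasing.
- exact: qD_itv.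
- exact: qD_itv.
- by move=> i; case: (xP i).
- by move=> i; case: (xP i).
- by near: u.
Unshelve. all: by end_near. Qed.

(** * Convergence in law of the rescaled error implies consistency *)

Lemma open_borel_measurable (R : realType) (s : nat) (A : set 'rV[R]_s) :
  open A -> measurable (A : set (borel_rV R s)).
Proof. by move=> oA; apply: sub_sigma_algebra. Qed.

Lemma closed_borel_measurable (R : realType) (s : nat) (A : set 'rV[R]_s) :
  closed A -> measurable (A : set (borel_rV R s)).
Proof.
move=> cA; rewrite -(setCK A); apply: measurableC.
by apply: open_borel_measurable; exact: closed_openC.
Qed.

Lemma continuous_borel_measurable (R : realType) (s : nat)
    (f : 'rV[R]_s -> R) :
  continuous f -> measurable_fun setT (f : borel_rV R s -> R).
Proof.
move=> cf; apply: (measurability _ (RGenOpens.measurableE R)).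
move=> _ [_ [a [b ->] <-]]; rewrite setTI; apply: open_borel_measurable.
by apply: open_comp => //; exact: interval_open.
Qed.

Lemma translate_scale_continuous (R : realType) (V : normedModType R) (a : R)
    (t : V) : continuous (fun x : V => a *: (x - t)).
Proof.
move=> x; apply: cvgZl_tmp; apply: cvgB; [exact: cvg_id|exact: cvg_cst].
Qed.

Lemma dist_continuous (R : realType) (V : normedModType R) (t : V) :
  continuous (fun x : V => `|x - t|).
Proof.
move=> x; apply: cvg_norm; apply: cvgB; [exact: cvg_id|exact: cvg_cst].
Qed.

Lemma dist_ge_measurable (R : realType) (s : nat) (t : 'rV[R]_s) (M : R) :
  measurable ([set x : 'rV[R]_s | M <= `|x - t|] : set (borel_rV R s)).
Proof.
apply: closed_borel_measurable.
have := @dist_continuous R 'rV[R]_s t.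
by move=> /continuous_closedP/(_ _ (@closed_ge R M)).
Qed.

Lemma borel_tight (R : realType) (s : nat) (mu : probability (borel_rV R s) R)
    (e : R) : 0 < e ->
  exists M : nat, (mu [set x | (M%:R <= `|x : 'rV[R]_s|)%R] < e%:E)%E.
Proof.
move=> e0; pose A (n : nat) : set (borel_rV R s) :=
  [set x | n%:R <= `|x : 'rV[R]_s|].
have mA n : measurable (A n).
  have := dist_ge_measurable (0 : 'rV[R]_s) n%:R.
  by under eq_set do rewrite subr0.
have A0 : \bigcap_n A n = set0.
  rewrite -subset0 => x /(_ (Num.truncn `|x : 'rV[R]_s|).+1 I).
  by rewrite /A/= leNgt truncnS_gt.
have : mu \o A @ \oo --> mu (\bigcap_n A n).
  apply: nonincreasing_cvg_mu => //.
  - by rewrite (le_lt_trans (probability_le1 _ _))// ltry.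
  - by rewrite A0.
  - move=> n m nm; apply/subsetPset => x; apply: le_trans.
    by rewrite ler_nat.
rewrite A0 measure0 => /(_ [set y | (y < e%:E)%E]) [].
  apply: open_nbhs_nbhs; split; first exact: open_ereal_lt_ereal.
  by rewrite /= lte_fin.
by move=> M _ /(_ M (leqnn M)) AM; exists M.
Qed.

Lemma cvge0P (R : realType) (u : nat -> \bar R) : (forall n, 0 <= u n)%E ->
  (forall e : R, 0 < e -> \forall n \near \oo, (u n <= e%:E)%E) ->
  u @ \oo --> (0 : \bar R)%E.
Proof.
move=> u0 H; apply/fine_cvgP; split.
  near=> n; rewrite ge0_fin_numE// (@le_lt_trans _ _ 1%:E) ?ltry//.
  by near: n; exact: H.
apply/cvgrPdist_le => e e0; near=> n.
have une : (u n <= e%:E)%E by near: n; exact: H.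
rewrite sub0r normrN/= ger0_norm ?fine_ge0// -lee_fin fineK//.
by rewrite ge0_fin_numE// (le_lt_trans une)// ltry.
Unshelve. all: by end_near. Qed.

(** A continuous function between the indicators of norm >= M + 1 and of
    norm >= M: it turns bounds on tails into integrals of a bounded continuous
    test function, the only data that convergence in law provides. *)
Definition cutoff (R : realType) (V : normedModType R) (M : R) : V -> R :=
  cst 1 \min (cst 0 \max (fun x => `|x| - M)).

Lemma cutoff_continuous (R : realType) (V : normedModType R) (M : R) :
  continuous (@cutoff R V M).
Proof.
move=> x; apply: (@continuous_min R V); first exact: cvg_cst.
apply: (@continuous_max R V); first exact: cvg_cst.
by apply: cvgB; [exact: norm_continuous|exact: cvg_cst].
Qed.

Lemma cutoff_itv (R : realType) (V : normedModType R) (M : R) (x : V) :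
  0 <= cutoff M x <= 1.
Proof. by rewrite /cutoff /= le_min ler01 le_max lexx/= ge_min lexx. Qed.

(** Choose M so that mu gives mass less than r to the vectors of norm at least
    M.  As soon as sqrt n * e >= M + 1, the event that Y n is at distance at least e
    from t has probability at most the expected cutoff of the rescaled error,
    whose limit is less than r. *)
Lemma cvg_in_law_consistent (d : measure_display) (T : measurableType d)
    (R : realType) (P : probability T R) (s : nat)
    (Y : nat -> {RV P >-> borel_rV R s}) (t : 'rV[R]_s)
    (mu : probability (borel_rV R s) R) :
  cvg_in_law P
    (fun n w => Num.sqrt (n%:R : R) *: ((Y n w : 'rV[R]_s) - t)) mu ->
  forall e : R, 0 < e ->
  P [set w | e <= `|(Y n w : 'rV[R]_s) - t|] @[n --> \oo] --> (0 : \bar R)%E.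
Proof.
move=> law e e0.
have mE n : measurable [set w | e <= `|(Y n w : 'rV[R]_s) - t|].
  rewrite -[X in measurable X]setTI.
  exact: (measurable_funPT (Y n)) measurableT _ (dist_ge_measurable t e).
apply: cvge0P => // r r0.
have [M muM] := borel_tight mu r0.
have mM : measurable ([set x | M%:R <= `|x : 'rV[R]_s|] : set (borel_rV R s)).
  have := dist_ge_measurable (0 : 'rV[R]_s) M%:R.
  by under eq_set do rewrite subr0.
have intM : (\int[mu]_x (cutoff M%:R (x : 'rV[R]_s))%:E < r%:E)%E.
  apply: le_lt_trans muM.
  rewrite -[X in (_ <= mu X)%E]setIT -integral_indic//.
  apply: ge0_le_integral => //.
  - by move=> x _; rewrite lee_fin; case/andP: (cutoff_itv M%:R (x : 'rV[R]_s)).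
  - apply/measurable_EFinP; apply: continuous_borel_measurable.
    exact: (@cutoff_continuous R 'rV[R]_s).
  - by apply/measurable_EFinP.
  move=> x _; rewrite lee_fin indicE; case: (boolP (x \in _)) => [_|].
    by case/andP: (cutoff_itv M%:R (x : 'rV[R]_s)).
  rewrite notin_setE /= => /negP; rewrite -ltNge => xM.
  rewrite /cutoff ge_min ge_max; apply/orP; right.
  by rewrite lexx/= subr_le0 ltW.
have cut_bounded : exists K : R, forall x : 'rV[R]_s, `|cutoff M%:R x| <= K.
  by exists 1 => x; have /andP[? ?] := cutoff_itv M%:R x; rewrite ger0_norm.
have := law _ (@cutoff_continuous R 'rV[R]_s M%:R) cut_bounded.
move=> /(_ [set y | (y < r%:E)%E]); case.
  by apply: open_nbhs_nbhs; split; [exact: open_ereal_lt_ereal|].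
move=> N _ HN.
near=> n.
have Nn : (N <= n)%N by near: n; exact: nbhs_infty_ge.
have := HN n Nn; rewrite /= => /ltW; apply: le_trans.
have nM : (M%:R + 1) <= Num.sqrt n%:R * e.
  rewrite -ler_pdivrMr// -[X in X <= _]ger0_norm; last first.
    by rewrite divr_ge0 ?addr_ge0 ?(ltW e0).
  rewrite -sqrtr_sqr ler_wsqrtr//.
  by near: n; exact: nbhs_infty_ger.
rewrite -[X in (P X <= _)%E]setIT -integral_indic//.
apply: ge0_le_integral => //.
- by apply/measurable_EFinP.
- apply/measurable_EFinP.
  pose h := fun y : 'rV[R]_s => cutoff M%:R (Num.sqrt n%:R *: (y - t)).
  apply: (@measurableT_comp _ _ _ _ _ _ (h : borel_rV R s -> R) _ (Y n)) => //.
  apply: continuous_borel_measurable => y.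
  apply: (@continuous_comp _ _ _
    (fun y : 'rV[R]_s => Num.sqrt n%:R *: (y - t)) (cutoff M%:R)).
    exact: (@translate_scale_continuous R 'rV[R]_s).
  exact: (@cutoff_continuous R 'rV[R]_s).
move=> w _; rewrite lee_fin indicE; case: (boolP (w \in _)) => [|_]; last first.
  by case/andP: (cutoff_itv M%:R (Num.sqrt n%:R *: (Y n w - t))).
rewrite inE /= => ew; rewrite /cutoff /= le_min lexx/= le_max.
rewrite normrZ ger0_norm ?sqrtr_ge0//.
by rewrite lerBrDr addrC (le_trans nM) ?orbT// ler_wpM2l// sqrtr_ge0.
Unshelve. all: by end_near. Qed.

(** * Continuous functions of a consistent estimator *)

Lemma closed_within_ge (R : realType) (T : topologicalType) (A : set T)
    (h : T -> R) (e : R) :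
  closed A -> {within A, continuous h} -> closed (A `&` [set x | e <= h x]).
Proof.
move=> cA /continuous_closedP ch.
have [V cV VA] := (closed_subspaceP _ _).1 (ch _ (@closed_ge R e)).
rewrite (_ : A `&` _ = V `&` A); first exact: closedI.
by rewrite VA setIC.
Qed.

(** Continuity of D at t makes deviations of D (Y n) imply deviations of Y n.
    Continuity on the rest of the closed set Theta serves measurability: the
    deviation event is then the preimage under Y n of a closed set, and P is
    only known to be monotone on measurable sets. *)
Lemma consistent_continuous_map (d : measure_display) (T : measurableType d)
    (R : realType) (P : probability T R) (s : nat) (Theta : set 'rV[R]_s)
    (D : 'rV[R]_s -> R) (Y : nat -> {RV P >-> borel_rV R s}) (t : 'rV[R]_s) :
  closed Theta -> {within Theta, continuous D} -> Theta t ->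
  (forall n w, (0 < n)%N -> Theta (Y n w)) ->
  (forall e : R, 0 < e ->
    P [set w | e <= `|(Y n w : 'rV[R]_s) - t|] @[n --> \oo]
      --> (0 : \bar R)%E) ->
  cvg_in_probability P (fun n w => D (Y n w)) (D t).
Proof.
move=> cTheta cD Tt YTheta Yt e e0.
have cE : closed (Theta `&` [set u | e <= `|D u - D t|]).
  apply: closed_within_ge => //; apply/subspace_continuousP => u Tu.
  apply: cvg_norm; apply: cvgB; last exact: cvg_cst.
  exact: (subspace_continuousP _ _).1 cD u Tu.
have [r r0 rD] : exists2 r : R, 0 < r &
    forall u, Theta u -> `|u - t| < r -> `|D u - D t| < e.
  have := (subspace_continuousP _ _).1 cD t Tt.
  move=> /cvgrPdist_lt/(_ e e0); rewrite near_withinE.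
  move=> /nbhs_ballP[r /= r0 rD]; exists r => // u Tu ut.
  by rewrite distrC; apply: rD => //; rewrite -ball_normE/= distrC.
apply: squeeze_cvge (Yt r r0); last exact: cvg_cst.
near=> n; apply/andP; split; first exact: measure_ge0.
have n0 : (0 < n)%N by near: n; exact: nbhs_infty_gt.
apply: le_measure; rewrite ?inE.
- rewrite (_ : [set _ | _] =
      setT `&` Y n @^-1` (Theta `&` [set u | e <= `|D u - D t|])).
    by apply: (measurable_funPT (Y n)) => //; exact: closed_borel_measurable.
  rewrite setTI; apply/seteqP; split=> [w /= ?|w []//].
  by split=> //; exact: YTheta.
- rewrite -[X in measurable X]setTI.
  exact: (measurable_funPT (Y n)) measurableT _ (dist_ge_measurable t r).
move=> w /=; apply: contraTT; rewrite -!ltNge => ?.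
by apply: rD => //; exact: YTheta.
Unshelve. all: by end_near. Qed.

(** * Uniform consistency of the estimated inequality curve *)

Theorem theorem3p5
  (R : realType) (d : measure_display) (T : measurableType d)
  (P : probability T R) (s k : nat) (hk : (s.+1 < k)%N)
  (Theta : set 'rV[R]_s) (F : 'rV[R]_s -> R -> R) (theta0 : 'rV[R]_s)
  (hF : forall t, Theta t -> is_cdf (F t))
  (X : nat -> {RV P >-> R})
  (X_ge0 : forall j w, 0 <= X j w)
  (X_indep : mutually_independent X)
  (X_cdf : forall j x, cdf (X j) x = (F theta0 x)%:E)
  (c : nat -> \bar R) (c0 : c 0%N = 0%E) (ck : c k = +oo%E)
  (c_incr : forall i j : nat, (i < j <= k)%N -> (c i < c j)%E)
  (g : 'rV[R]_s -> 'rV[R]_k) (hg : g = cell_prob F c)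
  (A1 : forall t, Theta t ->
    [/\ absolutely_continuous_on [set x : R | 0 <= x] (F t),
        {in [set x : R | 0 <= x] &, {homo F t : x y / x < y}} &
        F t 0 = 0])
  (A2 : interior Theta theta0 /\ compact Theta)
  (A3 : forall p : R, 0 < p < 1 ->
    {within Theta, continuous (fun t => quantile (F t) p)})
  (B1 : forall i, 0 < g theta0 0 i)
  (B2 : differentiable g theta0)
  (B3 : \rank ('J g theta0) = s)
  (B4 : {in Theta &, injective g} /\
    pinv Theta g q @[q --> within (g @` Theta) (nbhs (g theta0))]
      --> pinv Theta g (g theta0))
  (B5 : {within Theta, continuous g})
  (B6 : continuous_second_partials_near g theta0)
  (phi : R -> \bar R) (hphi : divergence_generator phi)
  (est : nat -> {RV P >-> borel_rV R s})
  (est_min : min_phi_divergence_estimator X c Theta g phi est)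
  (est_BAN : BAN_estimator g theta0 est) :
  cvg_in_probability P
    (fun n w => qD_dist (quantile (F (est n w))) (quantile (F theta0))) 0.
Proof.
have [/interior_subset T0 cT] := A2.
have LF t : Theta t -> lifetime_cdf (F t).
  by move=> Tt; have [? ? ?] := A1 _ Tt; split=> //; exact: hF.
(* The limit 0 is the distance of the true curve to itself. *)
rewrite -(qD_distxx (quantile (F theta0))).
have [mu _ law] := est_BAN.
apply: (@consistent_continuous_map _ _ _ _ _ Theta
  (fun t => qD_dist (quantile (F t)) (quantile (F theta0)))) => //.
- by apply: compact_closed => //; exact: (@norm_hausdorff R 'rV[R]_s).
- by apply: qD_dist_continuous => //; exact/lifetime_quantile/LF.
- by move=> n w n0; case: (est_min.2 n w n0).
- exact: cvg_in_law_consistent law.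
Qed.
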